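(* Let $t\in[0,1)$, let $n\ge 1$ be an integer, let $N\ge 0$ be the integer with $2^N\le n<2^{N+1}$, and put $m:=\sum_{i=0}^{N-1}t_{i+1}2^i$ (so $0\le m<2^N$), where $(t_j)_{j\ge 0}$ are the dyadic digits of $t$. Then $$\max\left(\frac12|T(m,n)|+\frac13V(n)-1,\ \frac14|T(n,m)|+\frac23V(m)-1\right)\le L_n^{(t)}\le 2V(m)+|T(n,m)|+2 .$$
   Context: **Dyadic group.** $G=\prod_{k=0}^{\infty}\{0,1\}$ is the Walsh (dyadic) group of sequences $x=(x_0,x_1,\dots)$, $x_k\in\{0,1\}$, with coordinatewise addition mod 2 and the product measure $\mu$ in which each coordinate takes the values $0,1$ with measure $1/2$ each ($\mu(G)=1$). **Walsh functions and Dirichlet kernels.** $r_k(x)=(-1)^{x_k}$. For $k\in\mathbb N=\{0,1,2,\dots\}$ with binary expansion $k=\sum_{i\ge 0}k_i2^i$, $k_i\in\{0,1\}$, put $w_k(x)=\prod_{i\ge 0}r_i(x)^{k_i}$ (Walsh–Paley system), and $D_n(x)=\sum_{k=0}^{n-1}w_k(x)$. **Dyadic digits of $t$.** For $t\in[0,1)$ write $t=\sum_{j=0}^\infty t_j2^{-(j+1)}$, $t_j\in\{0,1\}$; if $t$ is a dyadic rational, the expansion terminating in zeros is chosen. **Conjugate Dirichlet kernel and Lebesgue constant.** For $2^N\le n<2^{N+1}$, $$\widetilde D_n^{(t)}=1+\sum_{i=0}^{N-1}(-1)^{t_{i+1}}\left(D_{2^{i+1}}-D_{2^i}\right)+(-1)^{t_{N+1}}\left(D_n-D_{2^N}\right),\qquad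 L_n^{(t)}=\int_G\left|\widetilde D_n^{(t)}(x)\right|d\mu(x).$$ **Variation.** For $k\in\mathbb N$ with binary digits $(k_i)_{i\ge 0}$ (all but finitely many being $0$), $V(k)=\sum_{i=1}^\infty|k_i-k_{i-1}|+k_0$. **The sets $T$.** Let $n_i,m_i$ ($i\ge0$) be the binary digits of $n,m$, with the convention $n_{-1}=m_{-1}=0$. With $N$ determined by $2^N\le n<2^{N+1}$, $$T(n,m)=\{i\in\{0,1,\dots,N-1\}: n_i\ne n_{i-1},\ m_i=m_{i-1}\},$$ $$T(m,n)=\{i\in\{0,1,\dots,N-1\}: m_i\ne m_{i-1},\ n_i=n_{i-1}\}.$$ $|T|$ denotes the number of elements of a finite set $T$. *)

(* Defs.v *)
From HB Require Import structures.
From mathcomp Require Import all_boot all_order all_algebra.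
From mathcomp Require Import all_classical all_reals all_analysis.
From mathcomp Require Import ring lra.

Set Implicit Arguments.
Unset Strict Implicit.
Unset Printing Implicit Defensive.

Import Order.TTheory GRing.Theory Num.Theory.
Import numFieldNormedType.Exports.

Local Open Scope classical_set_scope.
Local Open Scope ring_scope.

(* The product sigma-algebra on {0,1}^nat is generated by the sets
   {x | x_k = 1}; the digit 1 is [true].  The group law is not needed below. *)
Definition coordinate_sets : set (set (nat -> bool)) :=
  range (fun k : nat => [set x : nat -> bool | x k]).

Definition dyadic_group := g_sigma_algebraType coordinate_sets.

Definition is_product_measure (R : realType) (mu : probability dyadic_group R) :=
  forall (n : nat) (A : nat -> set bool),
    mu [set x : dyadic_group | forall k, (k < n)%N -> A k (x k)] =
    (\prod_(k < n) bernoulli_prob (2^-1 : R) (A k))%E.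

Definition bit (k i : nat) : bool := odd (k %/ 2 ^ i).

(* The digit of index i - 1, with the convention that the digit of index -1
   is 0. *)
Definition prev_bit (k i : nat) : bool := if i is j.+1 then bit k j else false.

Definition rademacher (R : realType) (k : nat) (x : dyadic_group) : R :=
  (-1) ^+ (x k).

(* The digits of k of index i >= k vanish since k < 2 ^ k, so this is the full
   product over i >= 0. *)
Definition walsh (R : realType) (k : nat) (x : dyadic_group) : R :=
  \prod_(i < k) rademacher R i x ^+ bit k i.

Definition dirichlet (R : realType) (n : nat) (x : dyadic_group) : R :=
  \sum_(k < n) walsh R k x.

(* [d j] is the dyadic digit t_j, of weight 2 ^ -(j + 1). *)
Definition dyadic_digits (R : realType) (t : R) (d : nat -> bool) : Prop :=
  series (fun j => (d j)%:R / 2 ^+ j.+1 : R) @ \oo --> t /\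
  ((exists a p : nat, t = a%:R / 2 ^+ p) ->
   exists J, forall j, (J <= j)%N -> d j = false).

(* Meant for 2 ^ N <= n < 2 ^ N.+1, and [d] the dyadic digits of t. *)
Definition conj_dirichlet (R : realType) (d : nat -> bool) (N n : nat)
    (x : dyadic_group) : R :=
  1 + \sum_(i < N) (-1) ^+ d i.+1 *
        (dirichlet R (2 ^ i.+1) x - dirichlet R (2 ^ i) x)
    + (-1) ^+ d N.+1 * (dirichlet R n x - dirichlet R (2 ^ N) x).

Definition lebesgue_constant (R : realType) (mu : probability dyadic_group R)
    (d : nat -> bool) (N n : nat) : R :=
  \int[mu]_x `|conj_dirichlet R d N n x|.

(* The terms of index i > k vanish since k < 2 ^ k. *)
Definition dyadic_variation (k : nat) : nat :=
  (\sum_(1 <= i < k.+1) `|(bit k i)%:Z - (bit k i.-1)%:Z| + bit k 0)%N.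

(* The set T(a, b), as a set of indices i < N. *)
Definition changes_only_left (N a b : nat) : {set 'I_N} :=
  [set i : 'I_N | (bit a i != prev_bit a i) && (bit b i == prev_bit b i)]%SET.

(* Every t in [0, 1[ has dyadic digits, and the product measure exists: it is
   the law of the digits of a uniform point of [0, 1[. *)
Section non_vacuity.
Variable R : realType.
Implicit Types (t : R) (n q : nat) (A : nat -> set bool).

Let dig t n : bool := odd (Num.truncn (2 ^+ n.+1 * t)).

Let pow2_gt0 n : 0 < 2 ^+ n :> R. Proof. by rewrite exprn_gt0. Qed.

Let truncn_double (x : R) : 0 <= x ->
  Num.truncn (2 * x) = (odd (Num.truncn (2 * x)) + (Num.truncn x).*2)%N.
Proof.
move=> x0; suff <- : (Num.truncn (2 * x))./2 = Num.truncn x.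
  by rewrite odd_double_half.
apply/esym/truncn_def.
have /truncn_itv : 0 <= 2 * x by rewrite mulr_ge0.
set k := Num.truncn _; set h := k./2.
have -> : k = (odd k + h.*2)%N by rewrite odd_double_half.
rewrite -!natr1 -muln2 natrD natrM.
by case: (odd k) => /= /andP[? ?];
  apply/andP; split; lra.
Qed.

Lemma dyadic_digits_exist t : 0 <= t < 1 -> exists d, dyadic_digits t d.
Proof.
move=> /andP[t0 t1]; exists (dig t).
have pt0 n : 0 <= 2 ^+ n * t by rewrite mulr_ge0// ltW.
have digE n : ((dig t n)%:R : R) = (Num.truncn (2 ^+ n.+1 * t))%:R
    - 2 * (Num.truncn (2 ^+ n * t))%:R.
  rewrite /dig exprS -mulrA; have := truncn_double (pt0 n).
  set a := Num.truncn _; set b := Num.truncn (_ * t) => {2}->.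
  by rewrite -muln2 natrD natrM; ring.
have sumE n : series (fun j => (dig t j)%:R / 2 ^+ j.+1 : R) n =
    (Num.truncn (2 ^+ n * t))%:R / 2 ^+ n.
  elim: n => [|n IH].
    rewrite /series/= big_geq// expr0 mul1r divr1.
    by rewrite (@truncn_def _ t 0) ?t0.
  rewrite seriesSr IH digE; have := pow2_gt0 n; rewrite exprS => p0.
  by field; rewrite lt0r_neq0.
split.
- have lim0 : (fun n => t - 2^-1 ^+ n : R) @ \oo --> t.
    rewrite -[X in _ --> X]subr0; apply: cvgB; first exact: cvg_cst.
    by apply: cvg_expr; rewrite ger0_norm; lra.
  apply: (@squeeze_cvgr _ _ _ _ (fun n => t - 2^-1 ^+ n : R) (cst t)) => //;
    last exact: cvg_cst.
  apply: nearW => n /=; rewrite sumE exprVn.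
  have /andP[l u] := truncn_itv (pt0 n); have p0 := pow2_gt0 n.
  apply/andP; split; last by rewrite ler_pdivrMr// [t * _]mulrC.
  rewrite ler_pdivlMr// mulrBl mulVf ?lt0r_neq0// [t * _]mulrC.
  by move: u; rewrite -natr1; lra.
- move=> [a [p tE]]; exists p => j pj; rewrite /dig tE.
  have -> : 2 ^+ j.+1 * (a%:R / 2 ^+ p) = (2 ^ (j.+1 - p) * a)%:R :> R.
    rewrite natrM natrX; have p0 := pow2_gt0 p.
    rewrite -[in LHS](@subnK p j.+1) ?(leq_trans pj)// exprD.
    by field; rewrite lt0r_neq0.
  by rewrite natrK oddM subSn// oddX.
Qed.

Let block n q : set R := [set t | q%:R <= 2 ^+ n * t < q.+1%:R].

Let blockE n q :
  block n q = `[q%:R / 2 ^+ n, q.+1%:R / 2 ^+ n[%classic.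
Proof.
apply/seteqP; split => t; rewrite /block /= in_itv /=;
  by rewrite ler_pdivrMr// ltr_pdivlMr// mulrC.
Qed.

Let measurable_block n q : measurable (block n q).
Proof. by rewrite blockE; exact: measurable_itv. Qed.

Let block_truncn n q t : block n q t -> Num.truncn (2 ^+ n * t) = q.
Proof. exact: truncn_def. Qed.

Let measurable_dig n (B : set bool) : measurable [set t | B (dig t n)].
Proof.
have mdig : measurable [set t | dig t n].
  rewrite (_ : mkset _ = \bigcup_(q in [set q | odd q]) block n.+1 q).
    by apply: bigcup_measurable => q _; exact: measurable_block.
  apply/seteqP; split => t /=.
    rewrite /dig => o; exists (Num.truncn (2 ^+ n.+1 * t)) => //=.
    apply: truncn_itv; rewrite leNgt; apply/negP => /ltW t0.
    move: o; rewrite (truncn0Pn _ _)//.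
    by rewrite -ltNge (le_lt_trans t0).
  by move=> [q /= oq /block_truncn]; rewrite /dig => ->.
rewrite (_ : mkset _ =
  ([set t | dig t n] `&` [set _ | B true]) `|`
  (~` [set t | dig t n] `&` [set _ | B false])); last first.
  apply/seteqP; split => t /=; case: (dig t n) => //=; try by intuition.
  by move=> [[]|[]].
have mcst (P : Prop) : measurable [set _ : R | P].
  have [p|p] := pselect P.
    by rewrite (_ : mkset _ = setT)//; apply/seteqP; split.
  by rewrite (_ : mkset _ = set0)//; apply/seteqP; split.
by apply: measurableU; apply: measurableI => //; exact: measurableC.
Qed.

Let digits t : dyadic_group := dig t.

Let measurable_digits : measurable_fun [set: R] digits.
Proof.
apply: (@measurability _ _ R dyadic_group setT digits coordinate_sets) => // _ [_ [k _ <-] <-].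
by rewrite setTI; exact: (measurable_dig k (fun b => b)).
Qed.

Let cyl n m A : set R := [set t | forall k, (k < m)%N -> A k (dig t (n + k))].

Let measurable_cyl n m A : measurable (cyl n m A).
Proof.
rewrite (_ : cyl n m A = \bigcap_(k in `I_m) [set t | A k (dig t (n + k))]).
  by apply: bigcap_measurableType => k _; exact: measurable_dig.
by apply/seteqP; split.
Qed.

Let beta_half (B : set bool) : (bernoulli_prob (2^-1 : R) B =
  ((`[<B true>] + `[<B false>])%:R / 2)%:E)%E.
Proof.
have p0 : 0 <= (2^-1 : R) by lra.
have p1 : (NngNum p0)%:num <= 1 by rewrite /=; lra.
rewrite (bernoulli_dirac p1) measure_addE /= /mscale /= /dirac !indicE /=.
rewrite -!EFinM -EFinD natrD; congr _%:E.
have -> : `[<B true>] = (true \in B) by [].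
have -> : `[<B false>] = (false \in B) by [].
by lra.
Qed.

Let lebesgue_cyl m n q A :
  lebesgue_measure (block n q `&` cyl n m A) =
  ((2 ^- n)%:E * \prod_(k < m) bernoulli_prob (2^-1 : R) (A k))%E.
Proof.
elim: m n q A => [|m IH] n q A.
  rewrite big_ord0 mule1 (_ : cyl n 0 A = setT) ?setIT; last first.
    by apply/seteqP; split.
  rewrite blockE lebesgue_measure_itv/= lte_fin ltr_pM2r ?invr_gt0// ltr_nat.
  by rewrite ltnSn -EFinD -mulrBl -natr1 addrAC subrr add0r mul1r.
pose A' := fun k => A k.+1.
have split_block (b : bool) : block n.+1 (b + q.*2) `<=` block n q.
  move=> t; rewrite /block /= exprS -mulrA -[(_ + _).+1%:R]natr1 -[q.+1%:R]natr1.
  rewrite -muln2 natrD natrM.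
  by case: b => /= /andP[? ?]; apply/andP; split; lra.
have digb (b : bool) t : block n.+1 (b + q.*2) t -> dig t n = b.
  by move=> /block_truncn; rewrite /dig => ->; rewrite oddD odd_double addbF oddb.
have cylS t : cyl n m.+1 A t <-> A 0%N (dig t n) /\ cyl n.+1 m A' t.
  split => [h|[h0 h] [|k] km].
  - by split=> [|k km]; [have := h 0%N isT; rewrite addn0|rewrite addSnnS; exact: h].
  - by rewrite addn0.
  - by rewrite -addSnnS; exact: h.
pose P b := block n.+1 ((b : bool) + q.*2) `&` cyl n.+1 m A' `&` [set _ | A 0%N b].
have mP b : measurable (P b).
  apply: measurableI; first exact: measurableI.
  have [p|p] := pselect (A 0%N b).
    by rewrite (_ : mkset _ = setT)//; apply/seteqP; split.
  by rewrite (_ : mkset _ = set0)//; apply/seteqP; split.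
have -> : block n q `&` cyl n m.+1 A = P true `|` P false.
  apply/seteqP; split => t.
    move=> [bt /cylS[h0 h]].
    have : block n.+1 (dig t n + q.*2) t.
      move: (bt); rewrite /block /= => bt'.
      have t0 : 0 <= 2 ^+ n * t by case/andP: bt' => + _; exact: le_trans.
      have := truncn_double t0; rewrite (block_truncn bt) mulrA -exprS.
      rewrite -/(dig t n) => <-; apply: truncn_itv.
      by rewrite exprS -mulrA mulr_ge0.
    by move: h0; rewrite /P; case: (dig t n) => ? ?; [left|right].
  by case=> -[[bt h] h0]; (split; first exact: (split_block _ _ bt));
    apply/cylS; split => //; rewrite (digb _ _ bt).
have dP : P true `&` P false = set0.
  apply/seteqP; split => // t [[[bt _] _] [[bf _] _]].
  by have := digb _ _ bt; rewrite (digb _ _ bf).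
have PE b : lebesgue_measure (P b) = ((2 ^- n.+1)%:E *
    \prod_(k < m) bernoulli_prob (2^-1 : R) (A' k) * (`[<A 0%N b>]%:R)%:E)%E.
  rewrite /P; have [p|p] := pselect (A 0%N b).
    rewrite (_ : [set _ | _] = setT) ?setIT; last by apply/seteqP; split.
    by rewrite (asboolT p) mule1 IH.
  rewrite (_ : [set _ | _] = set0) ?setI0; last by apply/seteqP; split.
  by rewrite (asboolF p) mule0 measure0.
rewrite measureU//; [|exact: mP|exact: mP].
rewrite [X in (X + _)%E]PE [X in (_ + X)%E]PE.
rewrite big_ord_recl beta_half -ge0_muleDr ?lee_fin//.
rewrite -EFinD -natrD -!muleA; set Q := (\prod_(k < m) _)%E.
rewrite [RHS]muleA -EFinM (muleC Q) muleA -EFinM; congr (_%:E * _)%E.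
by rewrite exprS invfM; field; rewrite lt0r_neq0.
Qed.

Lemma product_measure_exists :
  exists mu : probability dyadic_group R, is_product_measure mu.
Proof.
have mD : measurable (block 0 0) by exact: measurable_block.
pose nu := pushforward (mrestr lebesgue_measure mD) digits.
have nu_cyl n A :
    nu [set x : dyadic_group | forall k, (k < n)%N -> A k (x k)] =
    (\prod_(k < n) bernoulli_prob (2^-1 : R) (A k))%E.
  have := lebesgue_cyl n 0 0 A; rewrite expr0 invr1 mul1e => <-.
  by rewrite /nu /pushforward /mrestr setIC.
have nuT : nu setT = 1%E.
  have := nu_cyl 0%N (fun=> setT); rewrite big_ord0 => <-.
  by congr (nu _); apply/seteqP; split.
have l1 : mrestr lebesgue_measure mD setT = 1%E := nuT.
pose l1P := Measure_isProbability.Build _ _ R (mrestr lebesgue_measure mD) l1.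
pose l : probability (g_sigma_algebraType R.-ocitv.-measurable) R :=
   HB.pack (mrestr lebesgue_measure mD) l1P.
pose digitsP := isMeasurableFun.Build _ _
  (g_sigma_algebraType R.-ocitv.-measurable) dyadic_group digits measurable_digits.
pose X : {mfun g_sigma_algebraType R.-ocitv.-measurable >-> dyadic_group} := HB.pack digits digitsP.
by exists (distribution l X) => n A; rewrite -nu_cyl.
Qed.
End non_vacuity.

(* Main.v *)
Require Import Defs.
From mathcomp Require Import all_boot all_order all_algebra.
From mathcomp Require Import all_classical all_reals all_analysis.
From mathcomp Require Import measurable_realfun ring lra zify.

(* On the set where x_s = 1 is the first nonzero coordinate (s < N), the kernel
   is A + r_N w B with A and B constant, w = 1 or -1, |A| = 2^(s+1) u_s(m) and
   |B| = 2^s u_s(n), where u_s(k) = |k_s - (k mod 2^s) / 2^s|.  Averaging over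
   the sign r_N replaces |A + r_N w B| by max(|A|, |B|), so the Lebesgue constant
   is the sum over s < N of max(u_s(m), u_s(n) / 2), plus a term in [0, 1] coming
   from the points whose first N coordinates vanish.  Moreover u_s(k) is
   u_(s-1)(k) / 2, or 1 minus this if k_s <> k_(s-1), and the three bounds follow
   from this recursion by telescoping. *)

Import Order.TTheory GRing.Theory Num.Theory.
Import numFieldNormedType.Exports.

Local Open Scope ring_scope.

(** * Binary digits and digit changes *)

Lemma modn_pow2S (k s : nat) :
  (k %% 2 ^ s.+1 = bit k s * 2 ^ s + k %% 2 ^ s)%N.
Proof.
have p0 : (0 < 2 ^ s)%N by rewrite expn_gt0.
rewrite {1}(divn_eq k (2 ^ s)) /bit; set q := (k %/ _)%N.
rewrite -{1}(odd_double_half q) mulnDl -muln2 -mulnA -expnS addnAC addnC.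
rewrite modnMDl modn_small// expnS.
by have := ltn_pmod k p0; case: (odd q) => /=; lia.
Qed.

Lemma bit_small (k i : nat) : (k < 2 ^ i)%N -> bit k i = false.
Proof. by move=> ki; rewrite /bit divn_small. Qed.

Lemma bit_pow2D (N k i : nat) : (i < N)%N -> bit (2 ^ N + k) i = bit k i.
Proof.
move=> iN; rewrite /bit divnDl ?dvdn_exp2l 1?ltnW// oddD -expnB// 1?ltnW//.
by rewrite oddX subn_eq0 leqNgt iN.
Qed.

Lemma bit_pow2D_top (N k : nat) : (k < 2 ^ N)%N -> bit (2 ^ N + k) N = true.
Proof.
by move=> kN; rewrite /bit divnDl// divnn expn_gt0/= divn_small.
Qed.

Lemma binary_sum_lt (N : nat) (e : nat -> bool) :
  (\sum_(i < N) e i * 2 ^ i < 2 ^ N)%N.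
Proof.
elim: N => [|N IH]; first by rewrite big_ord0.
rewrite big_ord_recr/= expnS; move: IH; set a := (\sum_(i < N) _)%N.
case: (e N); rewrite ?mul1n ?mul0n => aN; lia.
Qed.

Lemma bit_binary_sum (N : nat) (e : nat -> bool) (i : nat) :
  (i < N)%N -> bit (\sum_(j < N) e j * 2 ^ j) i = e i.
Proof.
elim: N => // N IH; rewrite ltnS leq_eqVlt big_ord_recr/= addnC.
have lt := binary_sum_lt N e.
case/orP => [/eqP ->|iN]; case: (e N) => /=; rewrite ?mul1n ?mul0n ?add0n.
- exact: bit_pow2D_top.
- exact: bit_small.
- by rewrite bit_pow2D// IH.
- exact: IH.
Qed.

Definition changes (k i : nat) : bool := bit k i != prev_bit k i.

(** All digits of index at least [M] vanish, so no change occurs beyond index [M]. Index [M] itself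
    stays in the sum, because a digit 1 at [M - 1] drops to 0 there. *)
Lemma dyadic_variationE (k M : nat) : (k < 2 ^ M)%N ->
  dyadic_variation k = (\sum_(i < M.+1) changes k i)%N.
Proof.
move=> kM.
have -> : dyadic_variation k = (\sum_(i < k.+1) changes k i)%N.
  rewrite /dyadic_variation big_add1/= big_mkord big_ord_recl/= addnC.
  congr (_ + _)%N; first by rewrite /changes/=; case: (bit k 0).
  apply: eq_bigr => i _; rewrite /changes /bump /= add1n /=.
  by case: (bit k _); case: (bit k _).
have tail a b : (k < 2 ^ a)%N -> (a <= b)%N ->
    (\sum_(i < b.+1) changes k i = \sum_(i < a.+1) changes k i)%N.
  move=> ka; elim: b => [|b IH]; first by rewrite leqn0 => /eqP ->.
  rewrite leq_eqVlt => /orP[/eqP -> //|ab].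
  rewrite big_ord_recr/= IH// /changes/= !bit_small ?addn0//.
    by rewrite (leq_trans ka) ?leq_exp2l.
  by rewrite (leq_trans ka) ?leq_exp2l// ltnW.
have [kleM|/ltnW Mlek] := leqP k M.
  by apply/esym/tail => //; exact: ltn_expl.
exact: tail.
Qed.

(** * The numbers u_s(k), their recursion and the three telescoped bounds *)

Definition digit_gap (R : realType) (k s : nat) : R :=
  `|(bit k s)%:R - (k %% 2 ^ s)%:R / 2 ^+ s|.

Section digit_gap.
Variable R : realType.
Local Notation gap := (digit_gap R).

Lemma digit_gap0 (k : nat) : gap k 0 = (changes k 0)%:R.
Proof.
rewrite /digit_gap expn0 modn1 mul0r subr0 /changes/=.
by case: bit; rewrite ?normr1 ?normr0.
Qed.

Lemma digit_gap_ge0 (k s : nat) : 0 <= gap k s.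
Proof. exact: normr_ge0. Qed.

(** With a = (k mod 2^s) / 2^s in [0, 1], the gap at s is |k_s - a| and the quotient at s + 1 is
    (k_s + a) / 2. For each of the four pairs of digits both absolute values open with a known
    sign. *)
Lemma digit_gapS (k s : nat) :
  gap k s.+1 = if changes k s.+1 then 1 - gap k s / 2 else gap k s / 2.
Proof.
rewrite /digit_gap /changes/= modn_pow2S natrD natrM natrX exprS.
have p0 : 0 < 2 ^+ s :> R by rewrite exprn_gt0.
set a := (k %% _)%:R / 2 ^+ s.
have -> : ((bit k s)%:R * 2 ^+ s + (k %% 2 ^ s)%:R) / (2 * 2 ^+ s) =
    ((bit k s)%:R + a) / 2 :> R by rewrite /a; field; rewrite lt0r_neq0.
have a0 : 0 <= a by rewrite divr_ge0// ltW.
have a1 : a <= 1.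
  rewrite ler_pdivrMr// mul1r -natrX ler_nat ltnW// ltn_pmod//.
  by rewrite expn_gt0.
case: (bit k s.+1); case: (bit k s) => /=; rewrite ?subr0 ?sub0r ?normrN.
- by rewrite !ger0_norm; lra.
- by rewrite !ger0_norm; lra.
- by rewrite !ger0_norm; lra.
- by rewrite !ger0_norm; lra.
Qed.

Lemma digit_gap_le1 (k s : nat) : gap k s <= 1.
Proof.
elim: s => [|s IH]; first by rewrite digit_gap0; case: changes.
have := digit_gap_ge0 k s; rewrite digit_gapS; case: ifP => _; lra.
Qed.

Variables n m : nat.

(** This is max(|A|, |B|) times the measure 2^-(s+1) of the set where x_s = 1 is the first nonzero
    coordinate. *)
Definition gap_max (s : nat) : R := Num.max (gap m s) (gap n s / 2).

Definition changes_only (a b i : nat) : bool := changes a i && ~~ changes b i.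

(* Sum of the inequalities
   2 * gap_max s <= 2 * changes m s + changes_only n m s + gap_max s.-1,
   without the last term for s = 0. *)
Lemma sum_gap_max_le (N : nat) :
  \sum_(s < N) gap_max s <=
    2 * (\sum_(s < N) changes m s)%:R +
    (\sum_(s < N) changes_only n m s)%:R :> R.
Proof.
case: N => [|N]; first by rewrite !big_ord0; lra.
suff : \sum_(s < N.+1) gap_max s + gap_max N <=
    2 * (\sum_(s < N.+1) changes m s)%:R +
    (\sum_(s < N.+1) changes_only n m s)%:R :> R.
  apply: le_trans; rewrite lerDl le_max digit_gap_ge0//.
elim: N => [|N IH].
  rewrite !big_ord1 /gap_max !digit_gap0 /changes_only.
  by case: changes; case: changes; rewrite /= maxEle; case: ifP; lra.
rewrite 3!(big_ord_recr N.+1) /= !natrD; move: IH.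
have := digit_gap_ge0 m N; have := digit_gap_le1 m N.
have := digit_gap_ge0 n N; have := digit_gap_le1 n N.
rewrite [gap_max N.+1]/gap_max [gap_max N]/gap_max !digit_gapS /changes_only.
by case: changes; case: changes; rewrite /= !maxEle;
  repeat case: ifP => ?; lra.
Qed.

(* Telescoping with the potential gap n s / 6. *)
Lemma sum_gap_max_ge_n (N : nat) :
  1 / 2 * (\sum_(s < N) changes_only m n s)%:R +
  1 / 3 * (\sum_(s < N) changes n s)%:R
    <= \sum_(s < N) gap_max s :> R.
Proof.
case: N => [|N]; first by rewrite !big_ord0; lra.
suff : 1 / 2 * (\sum_(s < N.+1) changes_only m n s)%:R +
    1 / 3 * (\sum_(s < N.+1) changes n s)%:R + gap n N / 6
    <= \sum_(s < N.+1) gap_max s :> R.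
  by have := digit_gap_ge0 n N; lra.
elim: N => [|N IH].
  rewrite !big_ord1 /gap_max !digit_gap0 /changes_only.
  by case: changes; case: changes; rewrite /= maxEle; case: ifP; lra.
(* This step fixes the weight 1/6: with u = [gap n N], a change of n adds 1/3 + (1 - u/2)/6 - u/6 on
   the left and at least (1 - u/2)/2 on the right, and both equal 1/2 - u/4. *)
rewrite 3!(big_ord_recr N.+1) /= !natrD; move: IH.
have := digit_gap_ge0 m N; have := digit_gap_le1 m N.
have := digit_gap_ge0 n N; have := digit_gap_le1 n N.
rewrite [gap_max N.+1]/gap_max !digit_gapS /changes_only.
by case: changes; case: changes; rewrite /= !maxEle;
  repeat case: ifP => ?; lra.
Qed.

(* Telescoping with the potential gap m s / 3. *)
Lemma sum_gap_max_ge_m (N : nat) :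
  1 / 4 * (\sum_(s < N) changes_only n m s)%:R +
  2 / 3 * (\sum_(s < N) changes m s)%:R
    <= \sum_(s < N) gap_max s :> R.
Proof.
case: N => [|N]; first by rewrite !big_ord0; lra.
suff : 1 / 4 * (\sum_(s < N.+1) changes_only n m s)%:R +
    2 / 3 * (\sum_(s < N.+1) changes m s)%:R + gap m N / 3
    <= \sum_(s < N.+1) gap_max s :> R.
  by have := digit_gap_ge0 m N; lra.
elim: N => [|N IH].
  rewrite !big_ord1 /gap_max !digit_gap0 /changes_only.
  by case: changes; case: changes; rewrite /= maxEle; case: ifP; lra.
(* The weight 1/3 is chosen likewise: with u = [gap m N], a change of m adds 2/3 + (1 - u/2)/3 - u/3
   = 1 - u/2 on the left and at least 1 - u/2 on the right. *)
rewrite 3!(big_ord_recr N.+1) /= !natrD; move: IH.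
have := digit_gap_ge0 m N; have := digit_gap_le1 m N.
have := digit_gap_ge0 n N; have := digit_gap_le1 n N.
rewrite [gap_max N.+1]/gap_max !digit_gapS /changes_only.
by case: changes; case: changes; rewrite /= !maxEle;
  repeat case: ifP => ?; lra.
Qed.

End digit_gap.

(** * Dirichlet kernels at a point with given first nonzero coordinate *)

Section walsh.
Variable R : realType.
Implicit Types x : dyadic_group.
Local Notation r := (rademacher R).
Local Notation w := (walsh R).
Local Notation D := (dirichlet R).

Lemma walshE (k M : nat) x : (k < 2 ^ M)%N ->
  w k x = \prod_(i < M) r i x ^+ bit k i.
Proof.
have tail a b : (k < 2 ^ a)%N -> (a <= b)%N ->
    \prod_(i < b) r i x ^+ bit k i = \prod_(i < a) r i x ^+ bit k i.
  move=> ka; elim: b => [|b IH]; first by rewrite leqn0 => /eqP ->.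
  rewrite leq_eqVlt => /orP[/eqP -> //|ab].
  by rewrite big_ord_recr/= IH// bit_small ?mulr1// (leq_trans ka) ?leq_exp2l.
move=> kM; rewrite /walsh; have [kleM|/ltnW Mlek] := leqP k M.
  by apply/esym/tail => //; exact: ltn_expl.
exact: tail.
Qed.

Lemma walsh_pow2D (N k : nat) x : (k < 2 ^ N)%N ->
  w (2 ^ N + k) x = r N x * w k x.
Proof.
move=> kN; rewrite (@walshE _ N.+1) ?expnS; last by lia.
rewrite big_ord_recr/= bit_pow2D_top// expr1 mulrC (@walshE k N)//.
by congr (_ * _); apply: eq_bigr => i _; rewrite bit_pow2D.
Qed.

Lemma dirichlet_pow2D (N q : nat) x : (q <= 2 ^ N)%N ->
  D (2 ^ N + q) x = D (2 ^ N) x + r N x * D q x.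
Proof.
move=> qN; rewrite /dirichlet big_split_ord/=; congr (_ + _).
rewrite mulr_sumr; apply: eq_bigr => i _.
by rewrite walsh_pow2D// (leq_trans (ltn_ord i)).
Qed.

Lemma dirichlet_pow2S (i : nat) x : D (2 ^ i.+1) x = (1 + r i x) * D (2 ^ i) x.
Proof. by rewrite expnS mul2n -addnn dirichlet_pow2D// mulrDl mul1r. Qed.

Lemma dirichlet_local (M q : nat) x y : (q <= 2 ^ M)%N ->
  (forall k, (k < M)%N -> x k = y k) -> D q x = D q y.
Proof.
move=> qM xy; apply: eq_bigr => k _.
have kM : (k < 2 ^ M)%N by rewrite (leq_trans (ltn_ord k)).
rewrite !(@walshE k M)//; apply: eq_bigr => i _.
by rewrite /rademacher xy.
Qed.

Lemma dirichlet_zeros (s q : nat) x : (forall k, (k < s)%N -> x k = false) ->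
  (q <= 2 ^ s)%N -> D q x = q%:R.
Proof.
move=> x0 qs; rewrite /dirichlet -[in RHS](card_ord q) -sumr_const.
apply: eq_bigr => k _; rewrite (@walshE k s) ?(leq_trans (ltn_ord k))//.
by rewrite big1// => i _; rewrite /rademacher x0// expr0 expr1n.
Qed.

Variables (s : nat) (x : dyadic_group).
Hypotheses (x0 : forall k, (k < s)%N -> x k = false) (xs : x s).

(** The doubling formula puts the factor 1 + r_s(x) = 0 into every such kernel. *)
Lemma dirichlet_pow2_eq0 (i : nat) : (s < i)%N -> D (2 ^ i) x = 0.
Proof.
elim: i => // i IH; rewrite ltnS leq_eqVlt dirichlet_pow2S => /orP[/eqP <-|/IH ->].
  by rewrite /rademacher xs expr1 subrr mul0r.
by rewrite mulr0.
Qed.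

(** Induction on the length of q, removing the leading digit 2^M. If M < s, all Walsh functions
    involved equal 1 and D_q = q. If M > s, D_(2^M) vanishes and only the sign r_M is lost. If M =
    s, r_s = -1 gives D_q = 2^s - (q - 2^s). *)
Lemma norm_dirichlet (q : nat) : `|D q x| = 2 ^+ s * digit_gap R q s.
Proof.
have p0 : 0 < 2 ^+ s :> R by rewrite exprn_gt0.
have -> : 2 ^+ s * digit_gap R q s =
    `|(bit q s)%:R * 2 ^+ s - (q %% 2 ^ s)%:R|.
  rewrite /digit_gap -{1}(gtr0_norm p0) -normrM; congr `|_|.
  by field; rewrite lt0r_neq0.
suff H M : (q < 2 ^ M)%N ->
    `|D q x| = `|(bit q s)%:R * 2 ^+ s - (q %% 2 ^ s)%:R|.
  by apply: (H q); exact: ltn_expl.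
elim: M q => [|M IH] q qM.
  have -> : q = 0%N by move: qM; rewrite expn0; lia.
  by rewrite /dirichlet big_ord0 bit_small ?expn_gt0// mod0n mul0r subrr.
have [|leq] := ltnP q (2 ^ M); first exact: IH.
have qE : q = (2 ^ M + (q - 2 ^ M))%N by rewrite subnKC.
have q'M : (q - 2 ^ M < 2 ^ M)%N by move: qM; rewrite expnS; lia.
rewrite qE; set q' := (q - _)%N in q'M *.
have [Ms|sM|eMs] := ltngtP M s.
- have lt : (2 ^ M + q' < 2 ^ s)%N.
    by rewrite -qE (leq_trans qM)// leq_exp2l.
  rewrite (dirichlet_zeros s _ x x0 (ltnW lt)).
  by rewrite (bit_small _ _ lt) (modn_small lt) mul0r sub0r normrN.
- rewrite (dirichlet_pow2D _ _ _ (ltnW q'M)) (dirichlet_pow2_eq0 _ sM) add0r.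
  rewrite normrM /rademacher normrX normrN1 expr1n mul1r (IH _ q'M).
  by rewrite (bit_pow2D _ _ _ sM) -(subnK (ltnW sM)) expnD modnMDl.
- subst M; rewrite (dirichlet_pow2D _ _ _ (ltnW q'M)).
  rewrite (dirichlet_zeros s _ x x0 (leqnn _)).
  rewrite (dirichlet_zeros s _ x x0 (ltnW q'M)) /rademacher xs expr1 mulN1r.
  by rewrite (bit_pow2D_top _ _ q'M) modnDl (modn_small q'M) mul1r natrX.
Qed.

End walsh.

(** * The conjugate kernel, split as A plus a term carrying r_N *)

Section conjugate.
Variables (R : realType) (d : nat -> bool).
Implicit Types x : dyadic_group.

Definition conj_head (N : nat) x : R :=
  1 + \sum_(i < N) (-1) ^+ d i.+1 *
        (dirichlet R (2 ^ i.+1) x - dirichlet R (2 ^ i) x).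

Lemma conj_dirichletE (N q : nat) x : (q <= 2 ^ N)%N ->
  conj_dirichlet R d N (2 ^ N + q) x =
  conj_head N x + (-1) ^+ d N.+1 * (rademacher R N x * dirichlet R q x).
Proof.
move=> qN; rewrite /conj_dirichlet (dirichlet_pow2D _ _ _ _ qN).
by rewrite [dirichlet R (2 ^ N) x + _]addrC addrK. Qed.

Lemma conj_head_local (N : nat) x y :
  (forall k, (k < N)%N -> x k = y k) -> conj_head N x = conj_head N y.
Proof.
move=> xy; congr (1 + _); apply: eq_bigr => i _; congr (_ * (_ - _)).
  by apply: (dirichlet_local R N _ _ _ _ xy); rewrite leq_exp2l.
by apply: (dirichlet_local R N _ _ _ _ xy); rewrite leq_exp2l// ltnW.
Qed.

Variables (N m : nat) (dm : forall i, (i < N)%N -> d i.+1 = bit m i).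

(** At such a point D_(2^(i+1)) - D_(2^i) = 2^i, so the head is 1 plus the sum of (1 - 2 m_i) 2^i
    over i < s. *)
Lemma conj_head_zeros (s : nat) x : (s <= N)%N ->
  (forall k, (k < s)%N -> x k = false) ->
  conj_head s x = 2 ^+ s - 2 * (m %% 2 ^ s)%:R.
Proof.
move=> + x0; elim: s x0 => [|s IH] x0 sN.
  by rewrite /conj_head big_ord0 expn0 modn1; lra.
rewrite /conj_head big_ord_recr/= addrA -/(conj_head s x) IH; first last.
- exact: ltnW.
- by move=> k ks; rewrite x0// ltnW.
rewrite !(dirichlet_zeros R s.+1)// ?leq_exp2l// modn_pow2S dm// natrD natrM.
by rewrite !natrX exprS; case: bit => /=; ring.
Qed.

(** The terms of index above s vanish and the term of index s is -(-1)^(m_s) 2^s. Added to 2^s - 2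
    (m mod 2^s), it gives 2^(s+1) m_s - 2 (m mod 2^s). *)
Lemma norm_conj_head (s : nat) x : (s < N)%N ->
  (forall k, (k < s)%N -> x k = false) -> x s ->
  `|conj_head N x| = 2 ^+ s.+1 * digit_gap R m s.
Proof.
move=> sN x0 xs.
have tail M : (s < M <= N)%N -> conj_head M x = conj_head s.+1 x.
  elim: M => // M IH; rewrite ltnS leq_eqVlt => /andP[/orP[/eqP -> //|sM] MN].
  rewrite /conj_head big_ord_recr/= addrA -/(conj_head M x) IH ?sM 1?ltnW//.
  by rewrite !(dirichlet_pow2_eq0 R s)// ?ltnS 1?ltnW// subrr mulr0 addr0.
rewrite tail ?sN ?leqnn// /conj_head big_ord_recr/= addrA -/(conj_head s x).
rewrite conj_head_zeros 1?ltnW// (dirichlet_pow2_eq0 R s)//.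
rewrite (dirichlet_zeros R s)// dm// natrX.
have p0 : 0 < 2 ^+ s :> R by rewrite exprn_gt0.
rewrite -(@ger0_norm _ (2 ^+ s.+1)) ?exprn_ge0// -normrM exprS.
by congr `|_|; case: bit => /=; field; rewrite lt0r_neq0.
Qed.

End conjugate.

(** * Integration over cylinders and the formula for the Lebesgue constant *)

Section dyadic_integral.
Local Open Scope classical_set_scope.
Local Open Scope ring_scope.
Variables (R : realType) (mu : probability dyadic_group R).
Hypothesis hmu : is_product_measure mu.
Implicit Types (x : dyadic_group) (f g : dyadic_group -> R).

Definition cylinder (K : nat) (y : nat -> bool) : set dyadic_group :=
  [set x | forall k, (k < K)%N -> x k = y k].

Lemma measurable_cylinder (K : nat) (y : nat -> bool) :
  measurable (cylinder K y).
Proof.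
have -> : cylinder K y = \bigcap_(k in `I_K) [set x | x k = y k].
  by apply/seteqP; split.
apply: bigcap_measurableType => k _.
have mk : measurable [set x : dyadic_group | x k].
  by apply: sub_sigma_algebra; exists k.
have [yk|yk] := boolP (y k).
  by rewrite (_ : [set x | _] = [set x : dyadic_group | x k]).
rewrite (_ : [set x | _] = ~` [set x : dyadic_group | x k]).
  exact: measurableC.
by apply/seteqP; split => x /=; case: (x k).
Qed.

Lemma cylinder_measure (K : nat) (y : nat -> bool) :
  mu (cylinder K y) = (2 ^- K)%:E.
Proof.
have := hmu K (fun k => [set y k]); rewrite /cylinder => ->.
have p0 : 0 <= (2^-1 : R) by lra.
have p1 : (NngNum p0)%:num <= 1 by rewrite /=; lra.
rewrite (eq_bigr (fun=> (2^-1 : R)%:E)) => [|k _].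
  by rewrite prodEFin prodr_const card_ord exprVn.
rewrite (bernoulli_dirac p1) measure_addE /= /mscale /= /dirac !indicE /=.
rewrite -!EFinM -EFinD; congr _%:E; rewrite !in_set1.
by case: (y k) => /=; lra.
Qed.

(** Pointwise, f is a finite combination of indicators of cylinders. The lengths may vary with the
    index, which serves both the uniform partition and the one by first nonzero coordinate. *)
Lemma integral_partition (I : finType) (K : I -> nat) (y : I -> nat -> bool)
    (c : I -> R) f :
  (forall i, 0 <= c i) ->
  (forall x, exists i, cylinder (K i) (y i) x) ->
  (forall i j x, cylinder (K i) (y i) x -> cylinder (K j) (y j) x -> i = j) ->
  (forall i x, cylinder (K i) (y i) x -> f x = c i) ->
  \int[mu]_x f x = \sum_i c i / 2 ^+ K i.
Proof.
move=> c0 cover disj fc; rewrite /Rintegral.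
have -> : (\int[mu]_x (f x)%:E =
    \int[mu]_x \sum_i (c i)%:E * (\1_(cylinder (K i) (y i)) x)%:E)%E.
  apply: eq_integral => x _; have [i Ei] := cover x.
  rewrite (bigD1 i)//= big1 ?adde0 => [|j ji].
    by rewrite indicE mem_set// mule1 (fc i).
  rewrite indicE memNset ?mule0// => Ej.
  by move: ji; rewrite (disj _ _ _ Ej Ei) eqxx.
have mE i := measurable_cylinder (K i) (y i).
rewrite ge0_integral_sum//; first last.
- by move=> i x _; rewrite mule_ge0// lee_fin.
- move=> i; apply: measurable_funeM; apply/measurable_EFinP.
  exact: measurable_indic.
rewrite (eq_bigr (fun i => (c i / 2 ^+ K i)%:E)) ?sumEFin// => i _.
rewrite ge0_integralZl_EFin//; last first.
  by apply/measurable_EFinP; exact: measurable_indic.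
by rewrite integral_indic// setIT [X in (_ * X)%E]cylinder_measure.
Qed.

Definition zero_extension {K : nat} (v : {ffun 'I_K -> bool}) : dyadic_group :=
  fun k => if insub k is Some i then v i else false.

Lemma zero_extensionE {K : nat} (v : {ffun 'I_K -> bool}) (i : 'I_K) :
  zero_extension v i = v i.
Proof. by rewrite /zero_extension valK. Qed.

Lemma integral_local (K : nat) f :
  (forall x, 0 <= f x) ->
  (forall x y, (forall k, (k < K)%N -> x k = y k) -> f x = f y) ->
  \int[mu]_x f x = \sum_(v : {ffun 'I_K -> bool}) f (zero_extension v) / 2 ^+ K.
Proof.
move=> f0 loc.
apply: (@integral_partition _ (fun=> K) (fun v => zero_extension v)) => //.
- move=> x; exists [ffun i : 'I_K => x i] => k kK.
  by rewrite (zero_extensionE _ (Ordinal kK)) ffunE.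
- move=> v v' x xv xv'; apply/ffunP => i.
  by rewrite -!zero_extensionE -xv// -xv'.
- by move=> v x; exact: loc.
Qed.

Definition flip (N : nat) x : dyadic_group := fun k => x k (+) (k == N).

(** This is the averaging over the sign r_N. Both integrals are finite sums over {0,1}^(N+1), and
    the flip acts there as an involution, so reindexing by it leaves the sum of f unchanged. *)
Lemma integral_flip (N : nat) f g :
  (forall x, 0 <= f x) -> (forall x, 0 <= g x) ->
  (forall x y, (forall k, (k < N.+1)%N -> x k = y k) -> f x = f y) ->
  (forall x y, (forall k, (k < N.+1)%N -> x k = y k) -> g x = g y) ->
  (forall x, f x + f (flip N x) = 2 * g x) ->
  \int[mu]_x f x = \int[mu]_x g x.
Proof.
move=> f0 g0 lf lg fg; rewrite (integral_local N.+1)// (integral_local N.+1 g)//.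
pose h (v : {ffun 'I_N.+1 -> bool}) := [ffun i => v i (+) (i == ord_max)].
have hK : involutive h by move=> v; apply/ffunP => i; rewrite !ffunE addbK.
have ext_h v : f (zero_extension (h v)) = f (flip N (zero_extension v)).
  apply: lf => k kN; rewrite /flip.
  by rewrite !(zero_extensionE _ (Ordinal kN)) ffunE.
rewrite -!mulr_suml; congr (_ / _).
pose S F : R := \sum_(v : {ffun 'I_N.+1 -> bool}) F v.
have : S (f \o zero_extension) = S (f \o zero_extension \o h).
  exact: (reindex_inj (inv_inj hK)).
have : S (f \o zero_extension) + S (f \o zero_extension \o h) =
    2 * S (g \o zero_extension).
  by rewrite /S -big_split mulr_sumr; apply: eq_bigr => v _; rewrite /= ext_h fg.
rewrite /S /=; lra.
Qed.

Lemma integral_leading_zeros (N : nat) (c : nat -> R) g :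
  (forall s, 0 <= c s) ->
  (forall s x, (s < N)%N -> (forall k, (k < s)%N -> x k = false) -> x s ->
     g x = c s) ->
  (forall x, (forall k, (k < N)%N -> x k = false) -> g x = c N) ->
  \int[mu]_x g x = \sum_(s < N) c s / 2 ^+ s.+1 + c N / 2 ^+ N.
Proof.
move=> c0 gs gN.
(* For s < N the cylinder prescribes s zeros followed by a 1. For s = N the length is cut to N, so
   the pattern's 1 at index N is never read and only N zeros are prescribed. *)
rewrite (@integral_partition 'I_N.+1 (fun s => minn s.+1 N)
  (fun s k => k == s) (fun s => c s))//.
- rewrite big_ord_recr/= (minn_idPr _)//; congr (_ + _).
  by apply: eq_bigr => s _; rewrite (minn_idPl _).
(* The piece containing x is indexed by its first nonzero coordinate, capped at N. *)
- move=> x; have ex : exists k, (k == N) || x k by exists N; rewrite eqxx.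
  case: (ex_minnP ex) => s xs smin.
  have sN : (s < N.+1)%N by rewrite ltnS smin// eqxx.
  exists (Ordinal sN) => k /=; rewrite leq_min ltnS => /andP[ks kN].
  have [ek|/negbTE nk] := eqVneq k s.
    by move: xs; rewrite -ek (ltn_eqF kN).
  apply/negbTE/negP => xk; have := smin k; rewrite xk orbT => /(_ isT).
  by move: ks; rewrite leq_eqVlt nk/= => /leq_trans h /h; rewrite ltnn.
- move=> i j x; wlog ij : i j / (i < j)%N => [H Ei Ej|Ei Ej].
    have [ij|ji|/val_inj//] := ltngtP i j; first exact: (H i j).
    exact/esym/(H j i).
  have iN : (i < N)%N by rewrite (leq_trans ij)// -ltnS.
  have := Ej i; rewrite Ei ?leq_min ?ltnSn// eqxx (ltn_eqF ij).
  by rewrite iN ltnS ltnW// => /(_ isT).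
- move=> s x Es; have [sN|sN] := ltnP s N.
    have x0 k : (k < s)%N -> x k = false.
      move=> ks; rewrite Es ?(ltn_eqF ks)// leq_min ltnS ltnW//.
      exact: ltn_trans sN.
    by apply: gs => //; rewrite Es// leq_min ltnSn.
  have -> : nat_of_ord s = N by apply/eqP; rewrite eqn_leq sN -ltnS ltn_ord.
  apply: gN => k kN; rewrite Es ?leq_min ?kN ?andbT ?ltnS.
    by rewrite ltn_eqF// (leq_trans kN).
  by rewrite ltnW// (leq_trans kN).
Qed.

Lemma normrDB (a b : R) : `|a + b| + `|a - b| = 2 * Num.max `|a| `|b|.
Proof.
by rewrite maxEle; case: (ger0P (a + b)); case: (ger0P (a - b));
  case: (ger0P a); case: (ger0P b); case: ifP; lra.
Qed.

(** The last term comes from the points whose first N coordinates vanish: there A = 2^N - 2m, |B| =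
    q, and the measure is 2^-N. *)
Lemma lebesgue_constantE (d : nat -> bool) (N m q : nat) :
  (forall i, (i < N)%N -> d i.+1 = bit m i) -> (m < 2 ^ N)%N -> (q <= 2 ^ N)%N ->
  lebesgue_constant mu d N (2 ^ N + q) =
  \sum_(s < N) gap_max R (2 ^ N + q) m s +
  Num.max `|2 ^+ N - 2 * m%:R| q%:R / 2 ^+ N.
Proof.
move=> dm mN qN; rewrite /lebesgue_constant.
(* The flip of coordinate N fixes A and [dirichlet R q] and negates r_N, so [normrDB] makes g the
   average of the absolute kernel over it. *)
pose g x := Num.max `|conj_head R d N x| `|dirichlet R q x|.
have loc_head x y : (forall k, (k < N.+1)%N -> x k = y k) ->
    conj_head R d N x = conj_head R d N y.
  by move=> xy; apply: conj_head_local => k kN; rewrite xy// ltnW.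
have loc_dir x y : (forall k, (k < N.+1)%N -> x k = y k) ->
    dirichlet R q x = dirichlet R q y.
  by move=> xy; apply: (dirichlet_local R N) => // k kN; rewrite xy// ltnW.
have -> : \int[mu]_x `|conj_dirichlet R d N (2 ^ N + q) x| = \int[mu]_x g x.
  apply: (integral_flip N) => [x|x|x y xy|x y xy|x].
  - by [].
  - by rewrite le_max normr_ge0.
  - by rewrite !conj_dirichletE// (loc_head _ _ xy) (loc_dir _ _ xy)
      /rademacher xy.
  - by rewrite /g (loc_head _ _ xy) (loc_dir _ _ xy).
  - have flipE k : (k < N)%N -> flip N x k = x k.
      by move=> kN; rewrite /flip (ltn_eqF kN) addbF.
    rewrite !conj_dirichletE// (conj_head_local _ _ _ _ _ flipE).
    rewrite (dirichlet_local _ _ _ _ _ qN flipE) {2}/rademacher /flip eqxx addbT.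
    rewrite /g; set b := dirichlet R q x.
    have -> : (-1) ^+ (~~ x N) = - rademacher R N x.
      by rewrite /rademacher; case: (x N); rewrite /= ?expr1 ?expr0 ?opprK.
    rewrite mulNr mulrN normrDB !normrM /rademacher !normrX normrN1 !expr1n.
    by rewrite !mul1r.
pose c s := if (s < N)%N then
    Num.max (2 ^+ s.+1 * digit_gap R m s) (2 ^+ s * digit_gap R (2 ^ N + q) s)
  else Num.max `|2 ^+ N - 2 * m%:R| q%:R.
rewrite (integral_leading_zeros N c); first last.
- move=> x x0; rewrite /c ltnn /g (conj_head_zeros R d N m)// modn_small//.
  by rewrite (dirichlet_zeros R N)// normr_nat.
- move=> s x sN x0 xs; rewrite /c sN /g (norm_conj_head _ _ _ _ dm _ _ sN x0 xs).
  rewrite (norm_dirichlet _ _ _ x0 xs); congr (Num.max _ (_ * _)).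
  (* As s < N, the numbers q and 2^N + q have the same digit at s and the same residue mod 2^s. *)
  rewrite /digit_gap (bit_pow2D _ _ _ sN); congr `|_ - _%:R / _|.
  by rewrite -(subnK (ltnW sN)) expnD modnMDl.
- by move=> s; rewrite /c; case: ifP => _; rewrite le_max;
    rewrite ?normr_ge0// mulr_ge0 ?exprn_ge0 ?digit_gap_ge0.
rewrite /c ltnn; congr (_ + _); apply: eq_bigr => s _; rewrite ltn_ord /gap_max.
have p0 : 0 < 2 ^+ s.+1 :> R by rewrite exprn_gt0.
rewrite maxr_pMl ?invr_ge0 1?ltW//; congr (Num.max _ _).
  by field; rewrite lt0r_neq0.
by move: p0; rewrite exprS => p0; field; rewrite lt0r_neq0// exprn_gt0.
Qed.

End dyadic_integral.

(** * Assembly of the estimates *)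

Lemma card_changes_only_left (N a b : nat) :
  #|changes_only_left N a b| = (\sum_(i < N) changes_only a b i)%N.
Proof.
rewrite -sum1_card big_mkcond/=; apply: eq_bigr => i _.
by rewrite /changes_only_left inE /changes_only /changes negbK; case: ifP.
Qed.

Theorem theorem1 (R : realType) (mu : probability dyadic_group R)
    (hmu : is_product_measure mu)
    (t : R) (ht : 0 <= t < 1) (d : nat -> bool) (hd : dyadic_digits t d)
    (n N : nat) (hn : (1 <= n)%N) (hN : (2 ^ N <= n < 2 ^ N.+1)%N) :
  let m := (\sum_(i < N) d i.+1 * 2 ^ i)%N in
  let T a b := changes_only_left N a b in
  Num.max (1 / 2 * #|T m n|%:R + 1 / 3 * (dyadic_variation n)%:R - 1)
          (1 / 4 * #|T n m|%:R + 2 / 3 * (dyadic_variation m)%:R - 1)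
    <= lebesgue_constant mu d N n
    <= 2 * (dyadic_variation m)%:R + #|T n m|%:R + 2.
Proof.
cbv zeta; set m := (\sum_(i < N) _)%N; rewrite !card_changes_only_left.
have mN : (m < 2 ^ N)%N := binary_sum_lt N (fun i => d i.+1).
have dm i : (i < N)%N -> d i.+1 = bit m i.
  by move=> iN; rewrite (bit_binary_sum N (fun i => d i.+1)).
case/andP: hN => Nn nN.
have nE : n = (2 ^ N + (n - 2 ^ N))%N by rewrite subnKC.
have qN : (n - 2 ^ N <= 2 ^ N)%N by move: nN; rewrite expnS; lia.
have := lebesgue_constantE R mu hmu d N m _ dm mN qN; rewrite -nE => ->.
(* The variations also count changes outside the range s < N: indices N and N + 1 for n, index N for
   m. They cost at most 2/3 in either lower bound, which the -1 absorbs. *)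
rewrite (dyadic_variationE _ _ nN) (dyadic_variationE _ _ mN) !big_ord_recr/=.
rewrite !natrD.
have bool_le1 (b : bool) : 0 <= (b%:R : R) <= 1 by case: b; rewrite /= ?lexx ler01.
have := bool_le1 (changes n N); have := bool_le1 (changes n N.+1).
have := bool_le1 (changes m N).
have := sum_gap_max_le R n m N; have := sum_gap_max_ge_n R n m N.
have := sum_gap_max_ge_m R n m N.
set last := Num.max `|_| _ / _.
have p0 : 0 < 2 ^+ N :> R by rewrite exprn_gt0.
have last0 : 0 <= last by rewrite divr_ge0 ?le_max ?normr_ge0// ltW.
(* Both |2^N - 2m| and q are at most 2^N; the +2 of the upper bound absorbs this term. *)
have last1 : last <= 1.
  rewrite ler_pdivrMr// mul1r ge_max -natrX ler_nat qN andbT ler_norml.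
  have : m%:R <= (2 ^ N)%:R :> R by rewrite ler_nat ltnW.
  by have := ler0n R m; move=> ? ?; apply/andP; split; lra.
rewrite ge_max => ? ? ? /andP[? ?] /andP[? ?] /andP[? ?].
by apply/andP; split; [apply/andP; split|]; lra.
Qed.
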